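(* For any nonempty bounded set $T\subset\mathbb{R}^d$ and any $\delta\in[0,\operatorname{diam}(T)]$, $$\mathcal{J}^{\mathrm{loc}}_\delta(T)\le\mathcal{J}_\delta(T)\le 4\,\mathcal{J}^{\mathrm{loc}}_{\delta/4}(T).$$
   Context: $B_2^d$ is the closed Euclidean unit ball and $\operatorname{diam}$ is the Euclidean diameter. For $A,B\subset\mathbb{R}^d$, the packing number is $M(A,B)=\sup\{|A_0|:A_0\subset A\text{ finite},\ x-y\notin B\text{ for all distinct }x,y\in A_0\}$. For $\varepsilon>0$ the local and global packing entropies of $T$ are $$h^{\mathrm{loc}}_T(\varepsilon)=\sup_{\delta\ge\varepsilon}\sup_{x\in T}\log M\big(T\cap(x+2\delta B_2^d),\delta B_2^d\big),\qquad h_T(\varepsilon)=\log M(T,\varepsilon B_2^d).$$ For $\delta\in[0,\operatorname{diam}(T)]$ the local and global truncated Dudley integrals are $$\mathcal{J}^{\mathrm{loc}}_\delta(T)=\int_\delta^{\operatorname{diam}(T)}\sqrt{h^{\mathrm{loc}}_T(\varepsilon)}\,d\varepsilon,\qquad \mathcal{J}_\delta(T)=\int_\delta^{\operatorname{diam}(T)}\sqrt{h_T(\varepsilon)}\,d\varepsilon .$$ *)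

(* Defs.v *)
From HB Require Import structures.
From mathcomp Require Export all_boot all_order all_algebra finmap.
From mathcomp Require Export all_classical all_reals all_analysis.
Export Order.TTheory GRing.Theory Num.Theory.
Export numFieldNormedType.Exports.

Set Implicit Arguments.
Unset Strict Implicit.
Unset Printing Implicit Defensive.

Local Open Scope classical_set_scope.
Local Open Scope ring_scope.

(* The norm that the library puts on 'rV[R]_d is the sup norm, so the Euclidean
   norm is defined separately, and boundedness, the diameter and the unit ball
   below refer to it. *)
Definition enorm (R : realType) (d : nat) (x : 'rV[R]_d) : R :=
  Num.sqrt (\sum_(i < d) x ord0 i ^+ 2).

Definition ebounded (R : realType) (d : nat) (T : set 'rV[R]_d) : Prop :=
  exists r : R, forall x, T x -> enorm x <= r.

(* [sup] is the genuine supremum when T is nonempty and bounded. *)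
Definition ediam (R : realType) (d : nat) (T : set 'rV[R]_d) : R :=
  sup [set enorm (x - y) | x in T & y in T].

Definition unit_eball (R : realType) (d : nat) : set 'rV[R]_d :=
  [set x | enorm x <= 1].

Definition dilate (R : realType) (d : nat) (r : R) (A : set 'rV[R]_d) :
  set 'rV[R]_d := [set r *: u | u in A].

Definition translate (R : realType) (d : nat) (x : 'rV[R]_d)
  (A : set 'rV[R]_d) : set 'rV[R]_d := [set x + u | u in A].

Section packing_entropy.
Local Open Scope ereal_scope.

Definition packing_number (R : realType) (d : nat) (A B : set 'rV[R]_d) :
  \bar R :=
  ereal_sup [set (#|` A0|%fset)%:R%:E | A0 in
    [set A0 : {fset 'rV[R]_d} |
      (forall x, x \in A0 -> A x) /\
      (forall x y, x \in A0 -> y \in A0 -> x <> y -> ~ B (x - y)%R)]].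

(* Entropies and integrals take values in [0, +oo]. At eps = 0, a null set for
   the integrals below, the entropies are given by the same formulas. *)
Definition local_entropy (R : realType) (d : nat) (T : set 'rV[R]_d) (eps : R) :
  \bar R :=
  ereal_sup [set
    ereal_sup [set
      lne (packing_number
             (T `&` translate x (dilate (2 * delta) (@unit_eball R d)))
             (dilate delta (@unit_eball R d)))
      | x in T]
    | delta in [set delta : R | (eps <= delta)%R]].

Definition entropy (R : realType) (d : nat) (T : set 'rV[R]_d) (eps : R) :
  \bar R := lne (packing_number T (dilate eps (@unit_eball R d))).

Definition local_dudley (R : realType) (d : nat) (T : set 'rV[R]_d) (delta : R) :
  \bar R :=
  \int[lebesgue_measure]_(eps in `[delta, ediam T]) sqrte (local_entropy T eps).

Definition dudley (R : realType) (d : nat) (T : set 'rV[R]_d) (delta : R) :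
  \bar R :=
  \int[lebesgue_measure]_(eps in `[delta, ediam T]) sqrte (entropy T eps).

End packing_entropy.

(* Main.v *)
Require Import Defs.
From mathcomp Require Import ring lra measurable_realfun.

Set Implicit Arguments.
Unset Strict Implicit.
Unset Printing Implicit Defensive.

(** The first inequality holds pointwise: a local packing at scale at least [e]
    is an [e]-packing of [T].  For the second, a greedy net gives
    [h(e) <= h(2e) + hloc(e)]; both entropies vanish at scales beyond the
    diameter, so iterating and using subadditivity of the square root,
    [sqrt h(e) <= \sum_k sqrt hloc(2^k e)] for [e > 0].  Integrating and
    substituting [2^k e], the [k]-th term contributes at most [2^-k] times the
    local integral, which yields the constant 2. *)

Local Open Scope classical_set_scope.
Local Open Scope ring_scope.

(** Keep the head [x], discard every element related to it, and recurse on the rest. Each element of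
    [s] is then related to some kept element; since [r] need not be transitive, the neighbourhoods
    may overlap and the count is only an inequality. *)
Lemma greedy_net (T : eqType) (r : rel T) (s : seq T) :
    reflexive r -> symmetric r ->
  exists N : seq T, [/\ uniq N, {subset N <= s},
    {in N &, forall x y, x != y -> ~~ r x y} &
    (size s <= \sum_(x <- N) size [seq y <- s | r x y])%N].
Proof.
move=> rr rs; have [n] := ubnP (size s).
elim: n s => // n IHn [_|x s /= /ltnSE sn].
  by exists [::]; rewrite big_nil.
have [|N [uN sub sepN cN]] := IHn [seq y <- s | ~~ r x y].
  by apply: leq_ltn_trans sn; rewrite size_filter count_size.
have farx y : y \in N -> ~~ r x y by move/sub; rewrite mem_filter => /andP[].
exists (x :: N); split => /=.
- by rewrite uN andbT; apply/negP => /farx; rewrite rr.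
- move=> y; rewrite !inE => /predU1P[->|/sub]; first by rewrite eqxx.
  by rewrite mem_filter => /andP[_ ->]; rewrite orbT.
- move=> y z; rewrite !inE => /predU1P[->|yN] /predU1P[->|zN] yz.
  + by rewrite eqxx in yz.
  + exact: farx.
  + by rewrite rs farx.
  + exact: sepN.
(* The neighbours of [x] pay for the discarded elements. The recursive bound pays for the others,
   and its counts only grow when taken in [x :: s] instead of the filtered list. *)
rewrite big_cons rr /= addSn ltnS -(count_predC (r x) s) -size_filter.
rewrite leq_add2l -size_filter; apply: (leq_trans cN); apply: leq_sum => y _.
apply: (@leq_trans (size [seq z <- s | r y z])); last by case: ifP => //= _.
by rewrite !size_filter count_filter; apply: sub_count => z /andP[].
Qed.

(** * Euclidean norm, balls and diameter *)

Section euclidean_norm.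
Variables (R : realType) (d : nat).
Implicit Types (x u v : 'rV[R]_d) (T : set 'rV[R]_d) (r : R).
Local Notation B := (@unit_eball R d).

Lemma enormZ r v : enorm (r *: v) = `|r| * enorm v.
Proof.
rewrite /enorm -sqrtr_sqr -sqrtrM ?sqr_ge0//; congr Num.sqrt.
by rewrite mulr_sumr; apply: eq_bigr => i _; rewrite mxE exprMn.
Qed.

Lemma enorm0 : enorm (0 : 'rV[R]_d) = 0.
Proof. by rewrite -(scale0r 0) enormZ normr0 mul0r. Qed.

Lemma dilate_eball0 r : dilate r B 0.
Proof. by exists 0; rewrite ?scaler0// /unit_eball /= enorm0. Qed.

Lemma dilate_eballN r v : dilate r B (- v) = dilate r B v.
Proof.
have sym w : dilate r B w -> dilate r B (- w).
  move=> [u Bu <-]; exists (- u); last by rewrite scalerN.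
  by rewrite /unit_eball /= -scaleN1r enormZ normrN1 mul1r.
by apply/propext; split => [/sym|/sym//]; rewrite opprK.
Qed.

Lemma dilate_eball_norm r v : 0 < r -> enorm v <= r -> dilate r B v.
Proof.
move=> r0 vr; exists (r^-1 *: v); last by rewrite scalerA divff ?gt_eqF// scale1r.
by rewrite /unit_eball /= enormZ gtr0_norm ?invr_gt0// mulrC ler_pdivrMr ?mul1r.
Qed.

Lemma le_dilate_eball r s : 0 <= r <= s -> dilate r B `<=` dilate s B.
Proof.
(* Membership via the norm requires a positive radius; in the degenerate case [s = 0] both balls
   reduce to the origin. *)
case/andP => r0 rs _ [u Bu <-]; have [s0|s0] := leP s 0.
  have -> : r = 0 by apply/le_anti; rewrite r0 (le_trans rs).
  rewrite scale0r; exact: dilate_eball0.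
apply: dilate_eball_norm => //; rewrite enormZ ger0_norm//.
by apply: le_trans rs; rewrite -[leRHS]mulr1; apply: ler_wpM2l.
Qed.

Lemma translateE x (A : set 'rV[R]_d) v : translate x A v = A (v - x).
Proof.
apply/propext; split => [[u Au <-]|Av]; first by rewrite addrC addKr.
by exists (v - x); rewrite // addrC subrK.
Qed.

Lemma enormB_le_ediam T x y : ebounded T -> T x -> T y ->
  enorm (x - y) <= ediam T.
Proof.
move=> [r Tr] Tx Ty; apply: ub_le_sup; last by exists x => //; exists y.
have r0 : 0 <= r by apply: le_trans (Tr _ Tx); exact: sqrtr_ge0.
have sum_le v : T v -> \sum_(i < d) v ord0 i ^+ 2 <= r ^+ 2.
  move=> /Tr vr; rewrite -[leLHS]sqr_sqrtr; last first.
    by apply: sumr_ge0 => i _; exact: sqr_ge0.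
  by rewrite ler_sqr ?nnegrE ?sqrtr_ge0.
(* [sup] dominates its set only if that set is bounded above. The bound [2 * r] comes from
   [(u - v)^2 <= 2 u^2 + 2 v^2] in each coordinate, which replaces the triangle inequality. *)
exists (Num.sqrt (4 * r ^+ 2)) => _ [u Tu [v Tv <-]].
rewrite ler_wsqrtr//.
apply: (@le_trans _ _ (\sum_(i < d) (2 * u ord0 i ^+ 2 + 2 * v ord0 i ^+ 2))).
  apply: ler_sum => i _; rewrite !mxE.
  have := sqr_ge0 (u ord0 i + v ord0 i); nra.
rewrite big_split /= -!mulr_sumr.
have := sum_le _ Tu; have := sum_le _ Tv; lra.
Qed.

End euclidean_norm.

(** * Packing numbers and entropies *)

Section packing.
Variables (R : realType) (d : nat).
Implicit Types (A B T : set 'rV[R]_d) (s : seq 'rV[R]_d) (e : R).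
Local Notation ball e := (dilate e (@unit_eball R d)).
Local Open Scope ereal_scope.

Lemma packing_numberP A B (b : \bar R) :
  (forall s, uniq s -> (forall x, x \in s -> A x) ->
    (forall x y, x \in s -> y \in s -> x <> y -> ~ B (x - y)%R) ->
    (size s)%:R%:E <= b) -> packing_number A B <= b.
Proof.
move=> sb; apply/ereal_supP => _ [X [XA XB] <-]; apply: sb => //; exact: fset_uniq.
Qed.

Lemma packing_number_ge A B s : uniq s -> (forall x, x \in s -> A x) ->
    (forall x y, x \in s -> y \in s -> x <> y -> ~ B (x - y)%R) ->
  (size s)%:R%:E <= packing_number A B.
Proof.
move=> us sA sB; apply: ereal_sup_ubound; exists [fset x in s]%fset.
  by split => [x|x y]; rewrite !inE; [exact: sA|exact: sB].
by rewrite card_fseq undup_id.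
Qed.

Lemma packing_number_ge1 A B : A !=set0 -> 1 <= packing_number A B.
Proof.
move=> [x Ax]; apply: (@packing_number_ge A B [:: x]) => // [y|y z].
  by rewrite inE => /eqP ->.
by rewrite !inE => /eqP -> /eqP ->.
Qed.

Lemma le_packing_number A A' B B' : A `<=` A' -> B' `<=` B ->
  packing_number A B <= packing_number A' B'.
Proof.
move=> AA BB; apply: packing_numberP => s us sA sB.
apply: packing_number_ge => // [x /sA/AA//|x y xs ys xy /BB].
exact: sB.
Qed.

Lemma lne_packing_le A A' B B' : A !=set0 -> A `<=` A' -> B' `<=` B ->
  lne (packing_number A B) <= lne (packing_number A' B').
Proof.
move=> A0 AA BB; have A1 := @packing_number_ge1 A B A0.
have A2 := le_packing_number AA BB.
by rewrite lee_lne// in_itv/= leey andbT (le_trans lee01)// (le_trans A1).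
Qed.

Lemma translate_ball_center T x r : T x -> (T `&` translate x (ball r)) x.
Proof.
by move=> Tx; split => //; rewrite translateE subrr; exact: dilate_eball0.
Qed.

Lemma local_entropy_ge T x e e' : T x -> (e <= e')%R ->
  lne (packing_number (T `&` translate x (ball (2 * e'))) (ball e'))
    <= local_entropy T e.
Proof.
move=> Tx ee; apply: le_ereal_sup_tmp; eexists; first by exists e'.
by apply: ereal_sup_ubound; exists x.
Qed.

Lemma entropy_ge0 T e : T !=set0 -> 0 <= entropy T e.
Proof. by move=> T0; rewrite lne_ge0 packing_number_ge1. Qed.

Lemma local_entropy_ge0 T e : T !=set0 -> 0 <= local_entropy T e.
Proof.
move=> [x Tx]; apply: le_trans (local_entropy_ge Tx (lexx e)).
by rewrite lne_ge0 packing_number_ge1//; exists x; exact: translate_ball_center.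
Qed.

Lemma entropy_nincr T e e' : T !=set0 -> (0 <= e <= e')%R ->
  entropy T e' <= entropy T e.
Proof. by move=> T0 ee; apply: lne_packing_le => //; exact: le_dilate_eball. Qed.

Lemma local_entropy_nincr T e e' : (e <= e')%R ->
  local_entropy T e' <= local_entropy T e.
Proof.
move=> ee; apply/ereal_supP => _ [e1 /= e1e <-]; apply: ereal_sup_ubound.
by exists e1 => //=; exact: le_trans e1e.
Qed.

Lemma local_entropy_le_entropy T e : (0 <= e)%R ->
  local_entropy T e <= entropy T e.
Proof.
move=> e0; apply/ereal_supP => _ [e' /= ee <-].
apply/ereal_supP => _ [x Tx <-]; apply: lne_packing_le.
- by exists x; exact: translate_ball_center.
- by move=> y [].
- by apply: le_dilate_eball; rewrite e0.
Qed.

(** Any two points of [T] differ by a vector of the [e]-ball, so a packing has at most one point.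
    This is what stops the doubling iteration. *)
Lemma entropy_large T e : T !=set0 -> ebounded T -> (ediam T <= e)%R ->
  (0 < e)%R -> entropy T e = 0.
Proof.
move=> T0 bT De e0; apply/eqP; rewrite lne_eq0 eq_le packing_number_ge1// andbT.
apply: packing_numberP => -[|x [|y s]] //= us sT sB; exfalso.
have xy : x <> y by move=> xy; move: us; rewrite xy inE eqxx.
apply: (sB x y) => //; rewrite ?inE ?eqxx ?orbT//.
apply: dilate_eball_norm => //; apply: le_trans De; apply: enormB_le_ediam => //.
  by apply: sT; rewrite inE eqxx.
by apply: sT; rewrite !inE eqxx orbT.
Qed.

Lemma local_entropy_large T e : T !=set0 -> ebounded T -> (ediam T <= e)%R ->
  (0 < e)%R -> local_entropy T e = 0.
Proof.
move=> T0 bT De e0; apply/eqP; rewrite eq_le local_entropy_ge0// andbT.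
by rewrite -(entropy_large T0 bT De e0) local_entropy_le_entropy// ltW.
Qed.

(* A maximal [2e]-separated subset of an [e]-packing covers it by balls of
   radius [2e], each of which contains a local [e]-packing. *)
Lemma entropy_doubling T e : T !=set0 ->
  entropy T e <= entropy T (2 * e) + local_entropy T e.
Proof.
move=> T0.
have P0 A B : A !=set0 -> packing_number A B \in `]0, +oo].
  by move=> A0; rewrite in_itv/= leey andbT (lt_le_trans _ (packing_number_ge1 _ A0)).
have h0 := @local_entropy_ge0 T e T0.
(* Exponentiating turns the claim into the counting bound: packing number at [e] at most [m] times
   the one at [2 * e]. The value [m = +oo] is allowed. *)
set m := expeR (local_entropy T e).
have m0 : m \in `]0, +oo].
  rewrite in_itv/= leey andbT /m; move: h0.
  by case: (local_entropy T e) => [r _||] //=; rewrite lte_fin expR_gt0.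
have mle x : T x ->
    packing_number (T `&` translate x (ball (2 * e))) (ball e) <= m.
  move=> Tx; have := local_entropy_ge Tx (lexx e).
  rewrite -[local_entropy T e]expeRK -/m lee_lne//.
    apply/(subitvP _)/(P0 _ _ (ex_intro _ x (translate_ball_center _ Tx))).
    by rewrite subitvE/= !bnd_simp.
  by apply/(subitvP _)/m0; rewrite subitvE/= !bnd_simp.
rewrite -[local_entropy T e]expeRK -/m /entropy -lneM ?P0//.
have le0 y : y \in (`]0, +oo] : interval (\bar R)) -> y \in `[0, +oo].
  by apply/subitvP; rewrite subitvE/= !bnd_simp.
have mul0 (y z : \bar R) : y \in `]0, +oo] -> z \in `]0, +oo] -> y * z \in `]0, +oo].
  by rewrite !in_itv/= !leey !andbT => y0 z0; exact: mule_gt0.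
rewrite lee_lne ?le0 ?mul0 ?P0//.
apply: packing_numberP => s us sT sB.
pose r : rel 'rV[R]_d := [rel x y | `[< ball (2 * e) (y - x)%R >]].
have [x|x y|N [uN Ns Nsep sN]] := @greedy_net _ r s.
- by rewrite /r /= subrr; apply/asboolP; exact: dilate_eball0.
- by rewrite /r /= -opprB dilate_eballN.
apply: (@le_trans _ _ ((size N)%:R%:E * m)); last first.
  apply: lee_wpmul2r; first by apply: ltW; move: m0; rewrite in_itv => /andP[].
  apply: packing_number_ge => // [x /Ns/sT//|x y xN yN /eqP xy].
  (* The relation [r x y] tests [y - x] while a packing tests [x - y], hence the swap. *)
  rewrite eq_sym in xy.
  by have /asboolPn := Nsep _ _ yN xN xy.
apply: (@le_trans _ _ (\sum_(x <- N) (size [seq y <- s | r x y])%:R%:E)).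
  by rewrite sumEFin -natr_sum lee_fin ler_nat.
have -> : (size N)%:R%:E * m = \sum_(x <- N) m.
  rewrite -sum1_size natr_sum -sumEFin ge0_sume_distrl//.
  by apply: eq_bigr => x _; rewrite mul1e.
rewrite big_seq [leRHS]big_seq; apply: lee_sum => x xN.
apply: le_trans (mle _ (sT _ (Ns _ xN))); apply: packing_number_ge.
- exact: filter_uniq.
- move=> y; rewrite mem_filter => /andP[/asboolP rxy ys].
  by split; [exact: sT|rewrite translateE].
- move=> y z; rewrite !mem_filter => /andP[_ ys] /andP[_ zs]; exact: sB.
Qed.

End packing.

(** * Integrals of nonincreasing functions along dyadic scales *)

Section dyadic.
Variable R : realType.
Local Open Scope ereal_scope.
Implicit Types (f g : R -> \bar R).
Local Notation mu := (@lebesgue_measure R).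

Lemma sqrte_subadditive (x y : \bar R) : 0 <= x -> 0 <= y ->
  sqrte (x + y) <= sqrte x + sqrte y.
Proof.
move: x y => [x||] [y||]//=; rewrite ?leey// !lee_fin => x0 y0.
rewrite -ler_sqr ?nnegrE ?sqrtr_ge0 ?addr_ge0 ?sqrtr_ge0//.
rewrite sqrrD !sqr_sqrtr ?addr_ge0// lerD2r lerDl.
by rewrite mulrn_wge0// mulr_ge0 ?sqrtr_ge0.
Qed.

(** Closed upper rays generate the measurable sets of the extended reals, and their preimages are
    initial segments of [D], hence intervals. *)
Lemma nonincreasing_emeasurable (D : set R) f : is_interval D ->
    {in D &, {homo f : x y / (x <= y)%R >-> y <= x}} ->
  measurable_fun D f.
Proof.
move=> iD fni; apply: (measurability (@ErealGenCInfty.G R)).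
  exact: ErealGenCInfty.measurableE.
move=> /= _ [_] [r] -> <-; apply: is_interval_measurable => s t/=.
rewrite !in_itv/= !andbT => -[Ds _] [Dt ft] u /andP[su ut].
have Du : D u by apply: (iD s t) => //; rewrite su.
by split => //; rewrite in_itv/= andbT (le_trans ft)// fni// inE.
Qed.

(** Lebesgue measure equals [c] times its pushforward under multiplication by [c]: the two agree on
    half-open intervals, and uniqueness extends this to all measurable sets. *)
Lemma ge0_integral_scale f (c : R) : (0 < c)%R -> measurable_fun setT f ->
    (forall x, 0 <= f x) ->
  \int[mu]_x f (c * x)%R = c^-1%:E * \int[mu]_x f x.
Proof.
move=> c0 mf f0.
pose phi : R -> measurableTypeR R := fun x => (c * x)%R.
have mphi : measurable_fun setT phi by exact: mulrl_measurable.
have cn : (0 <= c)%R by exact: ltW.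
have @nu : {measure set (measurableTypeR R) -> \bar R}.
  refine (mscale (NngNum cn) (pushforward mu phi)); exact: mphi.
have nuE A : measurable A -> mu A = nu A.
  apply: lebesgue_measure_unique => _ [[a b] _ <-].
  have preim : phi @^-1` `]a, b] = `](a / c)%R, (b / c)%R]%classic.
    apply/seteqP; split => x /=; rewrite !in_itv/= ltr_pdivrMr// ler_pdivlMr//;
      by rewrite /phi (mulrC x).
  transitivity (c%:E * mu `](a / c)%R, (b / c)%R]); last by rewrite -preim.
  rewrite !lebesgue_measure_itv/= !lte_fin ltr_pM2r ?invr_gt0//.
  case: ifPn => _; last by rewrite mule0.
  by rewrite -!EFinB -EFinM; congr EFin; rewrite mulrBr !(mulrC c) !divfK ?gt_eqF.
have -> : \int[mu]_x f (c * x)%R = \int[pushforward mu phi]_x f x.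
  by rewrite ge0_integral_pushforward//.
rewrite [in RHS](eq_measure_integral nu); last by move=> A mA _; exact: nuE.
rewrite ge0_integral_mscale//= muleA -EFinM mulVf ?gt_eqF// mul1e//.
Qed.

Lemma nneseries_geometric_half (x : \bar R) : 0 <= x ->
  \sum_(k <oo) ((2 ^+ k)^-1%:E * x) = 2%:E * x.
Proof.
have sum2 : \sum_(k <oo) (2 ^+ k)^-1%:E = 2%:E :> \bar R.
  apply/cvg_lim => //.
  have -> : (fun n => \sum_(0 <= k < n) (2 ^+ k)^-1%:E) =
      EFin \o series (geometric 1 (2^-1 : R)).
    apply/funext => n /=; rewrite /series /= sumEFin; congr EFin.
    by apply: eq_bigr => k _; rewrite mul1r exprVn.
  have : series (geometric 1 (2^-1 : R)) @ \oo --> (1 * (1 - 2^-1)^-1 : R)%R.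
    by apply: cvg_geometric_series; rewrite ger0_norm// invf_lt1// ltr1n.
  have -> : (1 * (1 - 2^-1)^-1 = 2 :> R)%R by field.
  by move=> h; apply: cvg_EFin; [exact: nearW|exact: h].
move/gee0P => [->|[r r0 ->]].
  (* For [x = +oo] the term [k = 0] alone is already infinite. *)
  under eq_eseriesr do rewrite gt0_muley ?lte_fin ?invr_gt0 ?exprn_gt0//.
  rewrite gt0_muley//; apply/eqP; rewrite eq_le leey /=.
  apply: (@le_trans _ _ (\sum_(0 <= k < 1) +oo)); first by rewrite big_nat1.
  exact: nneseries_lim_ge.
under eq_eseriesr do rewrite muleC.
by rewrite nneseriesZl// sum2 muleC.
Qed.

(** To be used with [f] and [g] the square roots of the global and local entropies. Dominating [f x]
    by the sum of the [g (2 ^+ k * x)] and rescaling each integral leaves the weights [2 ^- k],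
    whose sum is 2. *)
Lemma integral_dyadic_le f g (a b : R) : (0 <= a)%R ->
    (forall x : R, 0 <= f x) -> (forall x : R, 0 <= g x) ->
    {in `[0%R, +oo[%classic &, {homo f : x y / (x <= y)%R >-> y <= x}} ->
    {in `[0%R, +oo[%classic &, {homo g : x y / (x <= y)%R >-> y <= x}} ->
    (forall x : R, (0 < x)%R -> (b <= x)%R -> f x = 0) ->
    (forall x : R, (0 < x)%R -> (b <= x)%R -> g x = 0) ->
    (forall x : R, (0 < x)%R -> f x <= f (2 * x)%R + g x) ->
  \int[mu]_(x in `[a, b]) f x <= 2%:E * \int[mu]_(x in `[a, b]) g x.
Proof.
move=> a0 f0 g0 fni gni fb gb fg.
have sub0 : `[a, b] `<=` `[0%R, +oo[.
  by move=> x /=; rewrite !in_itv/= andbT => /andP[/(le_trans a0)].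
have mfg (h : R -> \bar R) : {in `[0%R, +oo[%classic &, {homo h : x y / (x <= y)%R >-> y <= x}} ->
    measurable_fun `[a, b] h.
  move=> hni; apply: (measurable_funS _ sub0); first exact: measurable_itv.
  exact: (nonincreasing_emeasurable (@interval_is_interval _ _) hni).
(* Extension by zero lets each rescaled integral run over the whole line. Nothing is lost: for
   positive [x] in [[a, b]] the points [2 ^+ k * x] never fall below [a], and beyond [b] the
   function [g] vanishes. *)
pose G := g \_ `[a, b].
have mG : measurable_fun setT G.
  apply: (iffLR (measurable_restrictT g (measurable_itv _))); exact: mfg.
have G0 x : 0 <= G x by rewrite /G /patch; case: ifP.
have mGk k : measurable_fun setT (fun x : R => G (2 ^+ k * x)%R).
  exact: (measurableT_comp mG (@mulrl_measurable R setT (2 ^+ k)%R)).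
have mS : measurable_fun setT (fun x : R => \sum_(k <oo) G (2 ^+ k * x)%R).
  apply: (@ge0_emeasurable_sum _ _ _ setT
    (fun k (x : R) => G (2 ^+ k * x)%R) predT) => [k x _ _|k _].
    exact: G0.
  exact: mGk.
have fsum n x : (0 < x)%R ->
    f x <= \sum_(0 <= k < n) g (2 ^+ k * x)%R + f (2 ^+ n * x)%R.
  move=> x0; elim: n => [|n IHn]; first by rewrite big_nil add0e expr0 mul1r.
  apply: (le_trans IHn); rewrite big_nat_recr//= -addeA leeD2l//.
  rewrite [leRHS]addeC exprS -mulrA.
  by apply: fg; rewrite mulr_gt0// exprn_gt0.
have fG x : x \in `[a, b] -> x != 0%R -> f x <= \sum_(k <oo) G (2 ^+ k * x)%R.
  move=> xab xn0; have x0 : (0 < x)%R.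
    rewrite lt_def xn0 /=; move: xab; rewrite in_itv/= => /andP[+ _].
    exact: le_trans.
  have pk k : (0 < 2 ^+ k * x)%R by rewrite mulr_gt0// exprn_gt0.
  (* Since [b / x < n < 2 ^ n], after [n] doublings the scale has passed [b] and the remainder
     [f (2 ^+ n * x)] is zero. *)
  pose n := (Num.truncn (b / x)).+1.
  have bn : (b <= 2 ^+ n * x)%R.
    rewrite -ler_pdivrMr//; apply: ltW; apply: (lt_trans (truncnS_gt _)).
    by rewrite -natrX ltr_nat ltn_expl.
  apply: (le_trans (fsum n x x0)); rewrite (fb _ (pk n) bn) adde0.
  apply: (@le_trans _ _ (\sum_(0 <= k < n) G (2 ^+ k * x)%R)); last first.
    by apply: nneseries_lim_ge.
  apply: lee_sum => k _; rewrite /G /patch; case: ifPn => //.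
  rewrite mem_setE in_itv/= negb_and -!ltNge => /orP[|/ltW kb]; last first.
    by rewrite gb.
  rewrite ltNge; case/negP; move: xab; rewrite in_itv/= => /andP[ax _].
  by apply: (le_trans ax); rewrite ler_peMl ?(ltW x0) ?exprn_ege1 ?ler1n.
(* If [a = 0], the point [0] lies in the domain but doubling never moves it, so the domination is
   only almost everywhere. *)
apply: (@le_trans _ _ (\int[mu]_(x in `[a, b]) \sum_(k <oo) G (2 ^+ k * x)%R)).
  apply: ae_ge0_le_integral => //.
  - exact: mfg.
  - by move=> x _; exact: nneseries_ge0.
  - exact: measurable_funTS.
  exists [set 0%R]; split => //; first exact: lebesgue_measure_set1.
  move=> x /= /not_implyP[xab]; apply: contra_notP => /eqP xn0.
  exact: fG.
rewrite (@integral_nneseries _ _ _ mu _ _ (fun k (x : R) => G (2 ^+ k * x)%R))//;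
  last by move=> k; exact: measurable_funTS (mGk k).
apply: (@le_trans _ _ (\sum_(k <oo) ((2 ^+ k)^-1%:E * \int[mu]_x G x))).
  apply: lee_nneseries => [k _ _|k _]; first exact: integral_ge0.
  rewrite -(ge0_integral_scale _ mG) ?exprn_gt0//.
  apply: ge0_subset_integral => //; exact: mGk.
by rewrite nneseries_geometric_half ?integral_ge0// -integral_mkcond.
Qed.

End dyadic.

(** * Comparison of the two Dudley integrals *)

Lemma sqrte_nincr (R : realType) (h : R -> \bar R) (D : set R) :
    (forall x, 0 <= h x)%E ->
    {in D &, {homo h : x y / (x <= y)%R >-> (y <= x)%E}} ->
  {in D &, {homo (fun x => sqrte (h x)) : x y / (x <= y)%R >-> (y <= x)%E}}.
Proof. by move=> h0 hni x y Dx Dy xy; rewrite lee_sqrt// hni. Qed.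

Theorem proposition5p5 (R : realType) (d : nat) (T : set 'rV[R]_d) (delta : R)
    (T_nonempty : T !=set0) (T_bounded : ebounded T)
    (delta_range : 0 <= delta <= ediam T) :
  (local_dudley T delta <= dudley T delta)%E /\
  (dudley T delta <= 4%:E * local_dudley T (delta / 4))%E.
Proof.
have /andP[delta0 deltaD] := delta_range.
have h0 e : (0 <= entropy T e)%E by exact: entropy_ge0.
have l0 e : (0 <= local_entropy T e)%E by exact: local_entropy_ge0.
have hni : {in `[0, +oo[%classic &,
    {homo (fun e => sqrte (entropy T e)) : x y / x <= y >-> (y <= x)%E}}.
  apply: sqrte_nincr => // x y; rewrite !inE /= !in_itv/= !andbT => x0 _ xy.
  by apply: entropy_nincr => //; rewrite x0.
have lni : {in `[0, +oo[%classic &,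
    {homo (fun e => sqrte (local_entropy T e)) : x y / x <= y >-> (y <= x)%E}}.
  by apply: sqrte_nincr => // x y _ _; exact: local_entropy_nincr.
have msub (h : R -> \bar R) (a : R) : 0 <= a ->
    {in `[0, +oo[%classic &, {homo h : x y / x <= y >-> (y <= x)%E}} ->
    measurable_fun `[a, ediam T] h.
  move=> a0 mh; apply: nonincreasing_emeasurable.
    exact: interval_is_interval.
  move=> x y; rewrite !inE/= !in_itv/= => /andP[ax _] /andP[ay _].
  by apply: mh; rewrite inE/= in_itv/= andbT (le_trans a0).
split.
  apply: ge0_le_integral => //; try exact: msub.
  - by move=> e _; exact: sqrte_ge0.
  - move=> e /=; rewrite in_itv/= => /andP[de _].
    by rewrite lee_sqrt// local_entropy_le_entropy// (le_trans delta0).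
(* The dyadic argument gives constant 2 with the same lower limit [delta]; the stated bound follows
   by raising 2 to 4 and enlarging the interval down to [delta / 4]. *)
apply: (@le_trans _ _ (2%:E * local_dudley T delta)%E).
  apply: integral_dyadic_le => //; try by move=> *; exact: sqrte_ge0.
  - by move=> e e0 De; rewrite entropy_large// sqrte0.
  - by move=> e e0 De; rewrite local_entropy_large// sqrte0.
  move=> e e0; apply: le_trans (sqrte_subadditive (h0 _) (l0 _)).
  by rewrite lee_sqrt ?adde_ge0// entropy_doubling.
apply: (@le_trans _ _ (4%:E * local_dudley T delta)%E).
  apply: lee_wpmul2r; last by rewrite lee_fin ler_nat.
  by apply: integral_ge0 => e _; exact: sqrte_ge0.
apply: lee_wpmul2l => //; apply: ge0_subset_integral => //.
- by apply: msub => //; rewrite divr_ge0.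
- by move=> e _; exact: sqrte_ge0.
by move=> e /=; rewrite !in_itv/= => /andP[de ->]; rewrite andbT; lra.
Qed.
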